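(* For every $k\in\mathbb{Z}_{\ge0}$ and every real $a>\frac12$, \[ \zeta_{HCB}(1-k,a)\in\frac{\Gamma(a+1)^2}{\Gamma(2a+1)}\left(\mathbb{Q}(a)+\frac{4^a}{\sqrt3}\,B\!\left(\tfrac14;a-\tfrac12,\tfrac12\right)\mathbb{Q}(a)\right), \] where $\mathbb{Q}(a)$ is the field generated by $a$ over $\mathbb{Q}$.
   Context: $\zeta_{HCB}(s,a):=\sum_{n=0}^{\infty}\frac{1}{\binom{2(n+a)}{n+a}(n+a)^s}$, with $\binom{x}{y}:=\frac{\Gamma(x+1)}{\Gamma(y+1)\Gamma(x-y+1)}$ for real $x,y$. $B(z;\alpha,\beta):=\int_0^z x^{\alpha-1}(1-x)^{\beta-1}\,dx$ is the incomplete beta function. *)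

(* Defs.v *)
From HB Require Import structures.
From mathcomp Require Import all_boot all_order all_algebra.
From mathcomp Require Import all_classical all_reals all_analysis.

Set Implicit Arguments.
Unset Strict Implicit.
Unset Printing Implicit Defensive.

Import Order.TTheory GRing.Theory Num.Theory.
Import numFieldNormedType.Exports.

Local Open Scope classical_set_scope.
Local Open Scope ring_scope.

(* The real Gamma function: Euler's integral on x > 0. *)
Definition Gamma_integral (R : realType) (x : R) : R :=
  \int[lebesgue_measure]_(t in `]0, +oo[) (t `^ (x - 1) * expR (- t)).

(* Extension to all reals through Gamma(x + 1) = x Gamma(x). The shift
   truncn (1 - x) is the least m with x + m > 0, hence 0 if x > 0. At the poles
   the product vanishes, so Gamma, and by x^-1 = 0 for x = 0 also 1 / Gamma,
   takes the value 0; thus Gamma_fun is only meaningful off the poles, but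
   1 / Gamma_fun is right everywhere. *)
Definition Gamma_fun (R : realType) (x : R) : R :=
  let m := Num.truncn (1 - x) in
  Gamma_integral (x + m%:R) / \prod_(i < m) (x + i%:R).

Definition rbinom (R : realType) (x y : R) : R :=
  Gamma_fun (x + 1) / (Gamma_fun (y + 1) * Gamma_fun (x - y + 1)).

Definition zetaHCB (R : realType) (s a : R) : R :=
  limn (series (fun n : nat =>
    1 / (rbinom (2 * (n%:R + a)) (n%:R + a) * (n%:R + a) `^ s))).

(* For 0 <= z <= 1; a Lebesgue integral, so it covers alpha < 1 as well, where
   the integrand is singular at 0. *)
Definition incomplete_beta (R : realType) (z alpha beta : R) : R :=
  \int[lebesgue_measure]_(x in `[0, z])
    (x `^ (alpha - 1) * (1 - x) `^ (beta - 1)).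

(* Q(a): the least subfield of R containing the rationals and a. As x / 0 = 0,
   [divring_closed] says exactly that S is a subfield. *)
Definition Q_adjoin (R : realType) (a : R) : set R :=
  smallest (fun S : set R => divring_closed (mem S))
           (range (@ratr R) `|` [set a]).

(* Main.v *)
Require Import Defs.
From mathcomp Require Import all_boot all_order all_algebra.
From mathcomp Require Import all_classical all_reals all_analysis.
From mathcomp Require Import measurable_realfun.
From mathcomp Require Import ring lra.

Import Order.TTheory GRing.Theory Num.Theory.
Import numFieldNormedType.Exports.

Local Open Scope classical_set_scope.
Local Open Scope ring_scope.

(* Put c(y) = Gamma(y + 1)^2 / Gamma(2 y + 1), so that
   zeta_HCB(1 - k, a) = sum_n c(n + a) (n + a)^(k - 1), and
   t(y) = c(y) / (c(a) y).  The functional equation of Gamma gives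
   2 (2 y + 1) t(y + 1) = y t(y).
   - Multiplying by (y + 1)^j and summing over y = n + a expresses the moment
     M_(j+1) = sum t(y) y^(j+1) through M_0, ..., M_j with coefficients in
     Q(a): the coefficient of M_(j+1) is 4 on one side and 1 on the other.
   - For M_0, let I(p) = B(1/4; p, 1/2).  Integration by parts gives
     p I(p) = (1/4)^p sqrt(3/4) + (p + 1/2) I(p + 1); with p = y - 1/2 this
     makes the sum of the t(y) telescope, which yields
     M_0 = (a - 1/2) / a * 4^a / sqrt 3 * B(1/4; a - 1/2, 1/2). *)

(** * Fundamental theorem of calculus on compact intervals and on their increasing unions *)

(** The integral of [g] stands on the right rather than being subtracted, so that the equation still
    makes sense after a monotone limit in which both integrals may become infinite. *)
Lemma FTC2_itv {R : realType} (F f g : R -> R) (a b : R) : a < b ->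
  (forall x, x \in `[a, b] -> {for x, continuous f}) ->
  (forall x, x \in `[a, b] -> {for x, continuous g}) ->
  (forall x, x \in `[a, b] -> is_derive x 1 F (f x - g x)) ->
  (\int[lebesgue_measure]_(x in `[a, b]) (f x)%:E =
   (F b - F a)%:E + \int[lebesgue_measure]_(x in `[a, b]) (g x)%:E)%E.
Proof.
move=> ab cf cg dF.
have cw (h : R -> R) : (forall x, x \in `[a, b] -> {for x, continuous h}) ->
    {within `[a, b], continuous h}.
  by move=> ch; apply/continuous_in_subspaceT => x; rewrite inE; exact: ch.
have ih (h : R -> R) : (forall x, x \in `[a, b] -> {for x, continuous h}) ->
    lebesgue_measure.-integrable `[a, b] (EFin \o h).
  by move=> /cw ch; apply: continuous_compact_integrable => //;
     exact: segment_compact.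
have cF x : x \in `[a, b] -> {for x, continuous F}.
  move=> xab; apply/differentiable_continuous/derivable1_diffP.
  by have [] := dF _ xab.
have E : (\int[lebesgue_measure]_(x in `[a, b]) (f x - g x)%:E =
    (F b)%:E - (F a)%:E)%E.
  apply: continuous_FTC2 => //.
  - by apply: cw => x xab; apply: cvgB; [exact: cf|exact: cg].
  - split.
    + move=> x xab; have [] // := dF x _.
      exact: subset_itv_oo_cc.
    + apply: cvg_at_right_filter; apply: cF.
      by rewrite in_itv/= lexx ltW.
    + apply: cvg_at_left_filter; apply: cF.
      by rewrite in_itv/= lexx ltW.
  - move=> x xab; rewrite derive1E.
    by have [] // := dF x (subset_itv_oo_cc xab).
have fg : lebesgue_measure.-integrable `[a, b] (EFin \o g) := ih _ cg.
have gfin : (\int[lebesgue_measure]_(x in `[a, b]) (g x)%:E)%E \is a fin_num.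
  exact: integrable_fin_num fg.
rewrite integralB_EFin// in E; [|exact: ih].
rewrite EFinB -E.
by rewrite subeK.
Qed.

(* Splitting [F'] into nonnegative parts lets the equation hold in [\bar R]
   even when both sides are +oo. *)
Lemma ge0_FTC_exhaustion {R : realType} (F f g : R -> R) (u v : R^nat)
    (D : set R) (l : R) :
  (forall x, D x -> is_derive x 1 F (f x - g x)) ->
  (forall n, u n < v n) -> nonincreasing_seq u -> nondecreasing_seq v ->
  D = \bigcup_n `[u n, v n]%classic ->
  (forall x, D x -> 0 <= f x) -> (forall x, D x -> 0 <= g x) ->
  (forall x, D x -> {for x, continuous f}) ->
  (forall x, D x -> {for x, continuous g}) ->
  F (v n) - F (u n) @[n --> \oo] --> l ->
  (\int[lebesgue_measure]_(x in D) (f x)%:E =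
   l%:E + \int[lebesgue_measure]_(x in D) (g x)%:E)%E.
Proof.
move=> dF uv niu ndv DE f0 g0 cf cg Fl.
have sub n x : x \in `[u n, v n] -> D x by move=> xn; rewrite DE; exists n.
(* Monotone convergence along the growing intervals, used for [f] and for [g]. *)
have cvgI (h : R -> R) : (forall x, D x -> 0 <= h x) ->
    (forall x, D x -> {for x, continuous h}) ->
    (\int[lebesgue_measure]_(x in `[u n, v n]) (h x)%:E @[n --> \oo] -->
     \int[lebesgue_measure]_(x in D) (h x)%:E)%E.
  move=> h0 ch; rewrite DE.
  apply: (@ge0_nondecreasing_set_cvg_integral _ (measurableTypeR R) R
    (fun n => `[u n, v n]%classic) (EFin \o h) lebesgue_measure) => //.
  - move=> m n mn; rewrite subsetEset; apply: subset_itv; rewrite bnd_simp.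
      exact: niu.
    exact: ndv.
  - move=> n; apply/measurable_EFinP.
    apply: subspace_continuous_measurable_fun => //.
    apply/continuous_in_subspaceT => x; rewrite inE => xn; exact: ch (sub _ _ xn).
  - by move=> n x /sub Dx; rewrite lee_fin h0.
apply: (cvg_unique _ (cvgI _ f0 cf)) => //.
rewrite (_ : (fun n => _) = (fun n => (F (v n) - F (u n))%:E +
    \int[lebesgue_measure]_(x in `[u n, v n]) (g x)%:E)%E); last first.
  apply/funext => n; apply: FTC2_itv => // x /sub; [exact: cf|exact: cg|exact: dF].
apply: cvgeD; last exact: cvgI.
- by rewrite fin_num_adde_defr.
- by apply: cvg_EFin => //; exact: nearW.
Qed.

(** * Growth bounds and vanishing boundary terms *)

(** Induction on [j], splitting q as s * s with s = sqrt q > 1: by Bernoulli's inequality a multiple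
    of s^n absorbs one factor n + c, and the induction hypothesis at s absorbs the other [j]
    factors. *)
Lemma pow_le_geometric {R : realType} (c q : R) (j : nat) : 0 <= c -> 1 < q ->
  exists2 C : R, 0 <= C & forall n, (n%:R + c) ^+ j <= C * q ^+ n.
Proof.
move=> c0; elim: j q => [|j IH] q q1.
  by exists 1 => // n; rewrite expr0 mul1r exprn_ege1// ltW.
have s1 : 1 < Num.sqrt q by rewrite -[X in X < _]sqrtr1 ltr_sqrt// (lt_trans _ q1).
have [C C0 HC] := IH _ s1.
set s := Num.sqrt q in s1 HC.
have s0 : 0 < s - 1 by rewrite subr_gt0.
have lin n : n%:R + c <= ((s - 1)^-1 + c) * s ^+ n.
  have bern : 1 + n%:R * (s - 1) <= s ^+ n.
    elim: n => [|n IHn]; first by rewrite mul0r addr0 expr0.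
    rewrite exprS -natr1.
    have : s * (1 + n%:R * (s - 1)) <= s * s ^+ n.
      by rewrite ler_wpM2l// ltW// (lt_trans _ s1).
    apply: le_trans; have : 0 <= n%:R * (s - 1) ^+ 2 by rewrite mulr_ge0// sqr_ge0.
    nra.
  rewrite mulrDl lerD//.
    rewrite mulrC ler_pdivlMr//; apply: le_trans bern.
    by rewrite lerDr.
  by rewrite ler_peMr// exprn_ege1// ltW.
exists (C * ((s - 1)^-1 + c)).
  by rewrite mulr_ge0// addr_ge0// invr_ge0 ltW.
move=> n; rewrite exprSr (_ : q = s * s); last first.
  by rewrite -expr2 sqr_sqrtr// ltW// (lt_trans _ q1).
rewrite exprMn mulrACA ler_pM ?exprn_ge0 ?addr_ge0//.
Qed.

Lemma continuous_powR_gt0 {R : realType} (p t : R) : 0 < t ->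
  {for t, continuous (fun y : R => y `^ p)}.
Proof.
move=> t0; apply/differentiable_continuous/derivable1_diffP.
by have [] := is_derive1_powR p t0.
Qed.

Lemma cvg_powR_invn {R : realType} (p c : R) : 0 < p -> 0 < c ->
  (c / n.+1%:R) `^ p @[n --> \oo] --> (0 : R).
Proof.
move=> p0 c0.
have /cvg_at_rightP/(_ (fun n => c / n.+1%:R)) := powR_cvg0 p0; apply; split.
  by move=> n; rewrite divr_gt0.
rewrite -[X in _ --> X](mulr0 c); apply: cvgMr.
exact: cvg_harmonic.
Qed.

Lemma cvg_powR_expRN {R : realType} (p : R) :
  (n%:R + 2) `^ p * expR (- (n%:R + 2)) @[n --> \oo] --> (0 : R).
Proof.
pose m := (Num.truncn p).+1.
have pm : p <= m%:R by rewrite ltW// truncnS_gt.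
(* Since e >= 2, the exponential is at most 2^-n; a polynomial bound by (3/2)^n then leaves the
   ratio 3/4. *)
have [C C0 HC] := @pow_le_geometric R 2 (3 / 2) m ltac:(lra) ltac:(lra).
apply: (@squeeze_cvgr _ _ _ _ (fun=> 0) (fun n => C * (3 / 4) ^+ n)).
- near=> n; rewrite mulr_ge0 ?powR_ge0 ?expR_ge0//=.
  have -> : (3 / 4 : R) ^+ n = (3 / 2) ^+ n * 2 ^- n.
    by rewrite -exprVn -exprMn; congr (_ ^+ _); field.
  rewrite mulrA ler_pM ?powR_ge0 ?expR_ge0//.
    apply: le_trans (HC n); rewrite -powR_mulrn; last by rewrite addr_ge0.
    by apply: ler_powR => //; have : 0 <= n%:R :> R by []; lra.
  rewrite expRN lef_pV2 ?posrE ?exprn_gt0 ?expR_gt0//.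
  apply: (@le_trans _ _ (expR n%:R)); last by rewrite ler_expR lerDl.
  rewrite -[n%:R]mul1r expRM_natr lerXn2r ?nnegrE ?expR_ge0//.
  by apply: le_trans (expR_ge1Dx 1).
- exact: cvg_cst.
- rewrite -[X in _ --> X](mulr0 C); apply: cvgMr.
  by apply: cvg_expr; rewrite ger0_norm; lra.
Unshelve. all: by end_near. Qed.

(** * Functional equation of Gamma *)

(** The summand 2 keeps the interval nondegenerate at n = 0, where the left end is 1, as
    [ge0_FTC_exhaustion] requires. *)
Lemma bigcup_itv_oy {R : realType} :
  `]0, +oo[%classic = \bigcup_n `[n.+1%:R^-1 : R, n%:R + 2]%classic.
Proof.
apply/seteqP; split => [x|x [n _]]; rewrite /= !in_itv/= ?andbT; last first.
  by case/andP => + _; apply: lt_le_trans; rewrite invr_gt0.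
(* The maximum of x and 1/x controls both endpoints with one index. *)
move=> x0; exists (Num.truncn (Num.max x x^-1)) => //=.
set M := Num.max _ _; set n := Num.truncn _.
have Mn : M < n.+1%:R := truncnS_gt _.
rewrite in_itv/=; apply/andP; split.
  rewrite -[leRHS]invrK lef_pV2 ?posrE ?invr_gt0// ltW// (le_lt_trans _ Mn)//.
  by rewrite le_max lexx orbT.
have : x < n.+1%:R by rewrite (le_lt_trans _ Mn)// le_max lexx.
by rewrite -natr1; lra.
Qed.

(** Integration by parts with the primitive -t^x e^-t. *)
Lemma Gamma_integralS {R : realType} (x : R) : 0 < x ->
  Gamma_integral (x + 1) = x * Gamma_integral x.
Proof.
move=> x0.
pose g t : R := t `^ (x - 1) * expR (- t).
have cpe (p t : R) : 0 < t -> {for t, continuous (fun t => t `^ p * expR (- t))}.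
  move=> t0; apply: cvgM; first exact: continuous_powR_gt0.
  apply: continuous_comp; first exact: opp_continuous.
  exact: continuous_expR.
have mg : measurable_fun (`]0, +oo[ : set R) (EFin \o g).
  apply/measurable_EFinP; apply: open_continuous_measurable_fun => //.
  by move=> t; rewrite inE/= in_itv/= andbT => t0; exact: cpe.
pose F t := - (t `^ x * expR (- t)).
have dF (t : R) : `]0, +oo[%classic t ->
    is_derive t 1 F (t `^ (x + 1 - 1) * expR (- t) - x * g t).
  rewrite /= in_itv/= andbT => t0.
  have ? := is_derive1_powR x t0.
  apply: is_derive_eq.
  rewrite /g addrK /GRing.scale/=; ring.
have E := @ge0_FTC_exhaustion R F
  (fun t => t `^ (x + 1 - 1) * expR (- t)) (fun t => x * g t)
  (fun n => n.+1%:R^-1) (fun n => n%:R + 2) `]0, +oo[ 0 dF.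
rewrite /Gamma_integral /Rintegral E.
- rewrite add0e.
  transitivity (fine (x%:E * \int[lebesgue_measure]_(t in `]0%R, +oo[) (g t)%:E)%E).
    congr fine; rewrite -ge0_integralZl_EFin//; last exact: ltW.
    by move=> t _; rewrite lee_fin mulr_ge0// ?powR_ge0// expR_ge0.
  (* [fine] sends infinite values to 0, so it commutes with scaling by x > 0 in all three cases. *)
  case: (\int[_]_(_ in _) _)%E => [r| |] //=.
    by rewrite gt0_muley ?lte_fin// mulr0.
  by rewrite gt0_muleNy ?lte_fin// mulr0.
- move=> n; apply: (@le_lt_trans _ _ 1); first by rewrite invf_le1// ler1n.
  by have : 0 <= n%:R :> R by []; lra.
- by move=> m n mn; rewrite lef_pV2 ?posrE// ler_nat ltnS.
- by move=> m n mn; rewrite lerD2r ler_nat.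
- exact: bigcup_itv_oy.
- by move=> t _; rewrite mulr_ge0// ?powR_ge0// expR_ge0.
- by move=> t _; rewrite !mulr_ge0// ?powR_ge0// ?expR_ge0// ltW.
- by move=> t; rewrite /= in_itv/= andbT => t0; exact: cpe.
- move=> t; rewrite /= in_itv/= andbT => t0; apply: cvgM; first exact: cvg_cst.
  exact: cpe.
(* Both boundary values vanish: exponential decay at infinity, and t^x -> 0 at 0 because x > 0. *)
- rewrite -[X in _ --> X]subr0 -[X in _ --> X - _]oppr0 -[X in _ --> _ - X]oppr0.
  apply: cvgB; apply: cvgN.
    exact: cvg_powR_expRN.
  rewrite -[X in _ --> X](mul0r (expR (- 0))); apply: cvgM.
    by have := @cvg_powR_invn R x 1 x0 ltr01; under eq_fun do rewrite div1r.
  apply: continuous_cvg; first exact: continuous_expR.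
  apply: cvgN; exact: cvg_harmonic.
Qed.

Lemma Gamma_funS {R : realType} (x : R) : 0 < x ->
  Gamma_fun (x + 1) = x * Gamma_fun x.
Proof.
(* For y > 0 the shift is 0 and the product is empty. *)
have E y : 0 < y -> Gamma_fun y = Gamma_integral y.
  move=> y0; rewrite /Gamma_fun (_ : Num.truncn (1 - y) = 0).
    by rewrite big_ord0 addr0 divr1.
  by apply/truncn0Pn; rewrite -ltNge; lra.
by move=> x0; rewrite !E ?addr_gt0// Gamma_integralS.
Qed.

(** * Bound and recurrence for the incomplete beta function *)

Lemma bigcup_itv_0c {R : realType} (z : R) : 0 < z ->
  `]0, z]%classic = \bigcup_n `[z / n.+2%:R, z]%classic.
Proof.
move=> z0; apply/seteqP; split => [x|x [n _]]; rewrite /= !in_itv/=; last first.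
  by case/andP => + ->; rewrite andbT; apply: lt_le_trans; rewrite divr_gt0.
case/andP => x0 xz; exists (Num.truncn (z / x)) => //=.
have Mn : z / x < (Num.truncn (z / x)).+1%:R := truncnS_gt _.
rewrite in_itv/= xz andbT ler_pdivrMr// -ler_pdivrMl// mulrC.
by rewrite (le_trans (ltW Mn))// ler_nat.
Qed.

Lemma continuous_beta_integrand {R : realType} (p q t : R) : 0 < t < 1 ->
  {for t, continuous (fun t : R => t `^ p * (1 - t) `^ q)}.
Proof.
case/andP => t0 t1; apply: cvgM; first exact: continuous_powR_gt0.
apply: (@continuous_comp _ _ _ (fun t : R => 1 - t) (fun y : R => y `^ q)).
  by apply: cvgB; [exact: cvg_cst|exact: cvg_id].
by apply: continuous_powR_gt0; rewrite subr_gt0.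
Qed.

Lemma measurable_beta_integrand {R : realType} (z p q : R) : 0 < z < 1 ->
  measurable_fun (`]0, z] : set R) (fun t : R => t `^ p * (1 - t) `^ q).
Proof.
case/andP => z0 z1; apply: subspace_continuous_measurable_fun => //.
apply/continuous_in_subspaceT => x; rewrite inE /= in_itv/= => /andP[x0 xz].
by apply: continuous_beta_integrand; rewrite x0 (le_lt_trans xz).
Qed.

(** Removing the null set {0} leaves a domain on which the integrand is continuous, ready for
    exhaustion. *)
Lemma incomplete_beta_oc {R : realType} (z p q : R) : 0 < z < 1 ->
  incomplete_beta z p q =
  fine (\int[lebesgue_measure]_(t in `]0%R, z])
    (t `^ (p - 1) * (1 - t) `^ (q - 1))%:E)%E.
Proof.
move=> z01; rewrite /incomplete_beta /Rintegral integral_itv_obnd_cbnd//.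
by apply/measurable_EFinP; exact: measurable_beta_integrand.
Qed.

(** For q <= 1 the factor (1 - t)^(q - 1) is largest at t = z, and t^(p - 1) integrates to z^p / p.
    The bound yields finiteness, and later the vanishing of the telescoping remainder. *)
Lemma integral_beta_le {R : realType} (z p q : R) : 0 < z < 1 -> 0 < p -> q <= 1 ->
  (\int[lebesgue_measure]_(t in `]0%R, z]) (t `^ (p - 1) * (1 - t) `^ (q - 1))%:E
   <= ((1 - z) `^ (q - 1) * z `^ p / p)%:E)%E.
Proof.
move=> z01 p0 q1; have /andP[z0 z1] := z01.
set c := (1 - z) `^ (q - 1).
pose F (t : R) := c / p * t `^ p.
have dF (t : R) : `]0, z]%classic t -> is_derive t 1 F (c * t `^ (p - 1) - 0).
  rewrite /= in_itv/= => /andP[t0 _].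
  have ? := is_derive1_powR p t0.
  apply: is_derive_eq; rewrite /GRing.scale/=; field.
  by rewrite gt_eqF.
have c0 : 0 <= c by exact: powR_ge0.
have cp t : `]0, z]%classic t -> {for t, continuous (fun t => c * t `^ (p - 1))}.
  rewrite /= in_itv/= => /andP[t0 _]; apply: cvgM; first exact: cvg_cst.
  exact: continuous_powR_gt0.
have E := @ge0_FTC_exhaustion R F (fun t => c * t `^ (p - 1)) (fun=> 0)
  (fun n => z / n.+2%:R) (fun=> z) `]0, z] (c * z `^ p / p) dF.
rewrite (_ : (c * z `^ p / p)%:E =
   (\int[lebesgue_measure]_(t in `]0%R, z]) (c * t `^ (p - 1))%:E)%E).
  apply: ge0_le_integral => //=.
  - by move=> t _; rewrite lee_fin mulr_ge0 ?powR_ge0.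
  - by apply/measurable_EFinP; exact: measurable_beta_integrand.
  - apply/measurable_EFinP; apply: subspace_continuous_measurable_fun => //.
    by apply/continuous_in_subspaceT => t; rewrite inE => tz; exact: cp.
  - move=> t; rewrite in_itv/= => /andP[t0 tz].
    rewrite lee_fin mulrC ler_wpM2r ?powR_ge0//.
    (* The exponent q - 1 is nonpositive, so reciprocals with exponent 1 - q >= 0 are compared. *)
    rewrite /c -[q - 1]opprB !powRN lef_pV2 ?posrE ?powR_gt0; [|lra..].
    apply: ge0_ler_powR; rewrite ?nnegrE; lra.
rewrite E//.
- by rewrite integral0 adde0.
- by move=> n; rewrite ltr_pdivrMr// ltr_pMr// ltr1n.
- move=> m n mn; rewrite ler_pM2l// lef_pV2 ?posrE// ler_nat !ltnS//.
- exact: bigcup_itv_0c.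
- by move=> t _; rewrite mulr_ge0 ?powR_ge0.
- by move=> t _; exact: cvg_cst.
- rewrite /F -[X in _ --> X]subr0; apply: cvgB.
    by rewrite mulrAC; exact: cvg_cst.
  rewrite -[X in _ --> X](mulr0 (c / p)); apply: cvgM; first exact: cvg_cst.
  have := @cvg_powR_invn R p z p0 z0.
  by rewrite -cvg_shiftS.
Qed.

Lemma integral_beta_fin_num {R : realType} (z p q : R) :
  0 < z < 1 -> 0 < p -> q <= 1 ->
  (\int[lebesgue_measure]_(t in `]0%R, z]) (t `^ (p - 1) * (1 - t) `^ (q - 1))%:E)%E
    \is a fin_num.
Proof.
move=> z01 p0 q1; apply/fin_numPlt; apply/andP; split.
  apply: (@lt_le_trans _ _ 0%E) => //; apply: integral_ge0 => t _.
  by rewrite lee_fin mulr_ge0 ?powR_ge0.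
by apply: le_lt_trans (ltry _); exact: integral_beta_le.
Qed.

Lemma incomplete_beta_ge0_le {R : realType} (z p q : R) :
  0 < z < 1 -> 0 < p -> q <= 1 ->
  0 <= incomplete_beta z p q <= (1 - z) `^ (q - 1) * z `^ p / p.
Proof.
move=> z01 p0 q1; rewrite incomplete_beta_oc// -!lee_fin.
rewrite fineK ?integral_beta_fin_num// integral_beta_le// andbT.
by apply: integral_ge0 => t _; rewrite lee_fin mulr_ge0 ?powR_ge0.
Qed.

(** The derivative of t^p (1 - t)^q is t^(p - 1) (1 - t)^(q - 1) (p - (p + q) t), a combination of
    the integrands for p and p + 1. *)
Lemma incomplete_beta_rec {R : realType} (z p q : R) :
  0 < z < 1 -> 0 < p -> 0 < q <= 1 ->
  p * incomplete_beta z p q =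
  z `^ p * (1 - z) `^ q + (p + q) * incomplete_beta z (p + 1) q.
Proof.
move=> z01 p0 /andP[q0 q1]; have /andP[z0 z1] := z01.
pose f r (t : R) := t `^ (r - 1) * (1 - t) `^ (q - 1).
have f_ge0 r t : 0 <= f r t by rewrite mulr_ge0 ?powR_ge0.
have cf r k t : `]0, z]%classic t -> {for t, continuous (fun t => k * f r t)}.
  rewrite /= in_itv/= => /andP[t0 tz]; apply: cvgM; first exact: cvg_cst.
  by apply: continuous_beta_integrand; rewrite t0 (le_lt_trans tz).
pose F (t : R) := t `^ p * (1 - t) `^ q.
have dF (t : R) : `]0, z]%classic t ->
    is_derive t 1 F (p * f p t - (p + q) * f (p + 1) t).
  rewrite /= in_itv/= => /andP[t0 tz].
  have t1 : 0 < 1 - t by lra.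
  have dp := is_derive1_powR p t0.
  have dq : is_derive t 1 (fun t : R => (1 - t) `^ q)
      (q * (1 - t) `^ (q - 1) * (0 - 1)).
    exact: (@is_derive1_comp R (fun y => y `^ q) (fun t => 1 - t) t _ _
      (is_derive1_powR q t1) _).
  apply: is_derive_eq.
  rewrite /f addrK /GRing.scale/=.
  rewrite -(mulr_powRB1 (ltW t0) p0) -(mulr_powRB1 (ltW t1) q0); ring.
have E := @ge0_FTC_exhaustion R F (fun t => p * f p t)
  (fun t => (p + q) * f (p + 1) t)
  (fun n => z / n.+2%:R) (fun=> z) `]0, z] (F z) dF.
have Z r k : 0 <= k -> (\int[lebesgue_measure]_(t in `]0%R, z]) (k * f r t)%:E =
    k%:E * \int[lebesgue_measure]_(t in `]0%R, z]) (f r t)%:E)%E.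
  move=> k0; rewrite -ge0_integralZl_EFin//.
  - by move=> t _; rewrite lee_fin.
  - by apply/measurable_EFinP; exact: measurable_beta_integrand.
have pq : 0 <= p + q by rewrite addr_ge0 ?ltW.
have p1 : 0 < p + 1 by rewrite addr_gt0.
(* Both beta integrals are finite, so the identity may be proved in the extended reals. *)
apply: EFin_inj; rewrite EFinD !EFinM !incomplete_beta_oc//.
rewrite !fineK ?integral_beta_fin_num//.
rewrite -!Z// ?ltW// E//.
- by move=> n; rewrite ltr_pdivrMr// ltr_pMr// ltr1n.
- by move=> m n mn; rewrite ler_pM2l// lef_pV2 ?posrE// ler_nat !ltnS.
- exact: bigcup_itv_0c.
- by move=> t _; rewrite mulr_ge0// ltW.
- by move=> t _; rewrite mulr_ge0.
- exact: cf.
- exact: cf.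
- rewrite -[X in _ --> X]subr0; apply: cvgB; first exact: cvg_cst.
  have zn : z / n.+2%:R @[n --> \oo] --> (0 : R).
    rewrite -[X in _ --> X](mulr0 z); apply: cvgM; first exact: cvg_cst.
    by have := @cvg_harmonic R; rewrite -cvg_shiftS.
  rewrite /F -[X in _ --> X](mul0r ((1 - 0) `^ q)); apply: cvgM.
    have := @cvg_powR_invn R p z p0 z0.
    by rewrite -cvg_shiftS.
  have z1n : 1 - z / n.+2%:R @[n --> \oo] --> (1 - 0 : R).
    by apply: cvgB => //; exact: cvg_cst.
  apply: (cvg_comp _ (fun y : R => y `^ q) z1n).
  by apply: continuous_powR_gt0; rewrite subr0.
Qed.

(** * The field Q(a) and spans over it *)

Lemma Q_adjoin_gen {R : realType} (a : R) : Q_adjoin a a.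
Proof. by move=> S [_]; apply; right. Qed.

Lemma Q_adjoin_ratr {R : realType} (a : R) (r : rat) : Q_adjoin a (ratr r).
Proof. by move=> S [_]; apply; left; exists r. Qed.

Lemma Q_adjoin_nat {R : realType} (a : R) (n : nat) : Q_adjoin a n%:R.
Proof. by rewrite -ratr_nat; exact: Q_adjoin_ratr. Qed.

Lemma Q_adjoin0 {R : realType} (a : R) : Q_adjoin a 0.
Proof. exact: (Q_adjoin_nat a 0%N). Qed.

Lemma Q_adjoin1 {R : realType} (a : R) : Q_adjoin a 1.
Proof. exact: (Q_adjoin_nat a 1%N). Qed.

Lemma Q_adjoinB {R : realType} (a x y : R) :
  Q_adjoin a x -> Q_adjoin a y -> Q_adjoin a (x - y).
Proof.
move=> Qx Qy S SP; have /set_mem : x - y \in S; last by [].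
by case: SP.1 => _ + _; apply; rewrite inE; [exact: Qx|exact: Qy].
Qed.

Lemma Q_adjoin_div {R : realType} (a x y : R) :
  Q_adjoin a x -> Q_adjoin a y -> Q_adjoin a (x / y).
Proof.
move=> Qx Qy S SP; have /set_mem : x / y \in S; last by [].
by case: SP.1 => _ _; apply; rewrite inE; [exact: Qx|exact: Qy].
Qed.

(** [divring_closed] speaks of differences and quotients; sums and products are obtained as x - (0 -
    y) and x / (1 / y). *)
Lemma Q_adjoinD {R : realType} (a x y : R) :
  Q_adjoin a x -> Q_adjoin a y -> Q_adjoin a (x + y).
Proof.
move=> Qx Qy; rewrite -[y]opprK -[- y]sub0r; apply: Q_adjoinB => //.
by apply: Q_adjoinB => //; exact: Q_adjoin0.
Qed.

Lemma Q_adjoinM {R : realType} (a x y : R) :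
  Q_adjoin a x -> Q_adjoin a y -> Q_adjoin a (x * y).
Proof.
move=> Qx Qy; rewrite -[y]invrK -[y^-1]div1r; apply: Q_adjoin_div => //.
by apply: Q_adjoin_div => //; exact: Q_adjoin1.
Qed.

Lemma Q_adjoinX {R : realType} (a x : R) (n : nat) :
  Q_adjoin a x -> Q_adjoin a (x ^+ n).
Proof.
move=> Qx; elim: n => [|n IH]; first exact: Q_adjoin1.
by rewrite exprS; exact: Q_adjoinM.
Qed.

(** The Q(a)-vector space spanned by 1 and [T]. *)
Definition Q_adjoin_span {R : realType} (a T : R) : set R :=
  [set p + T * q | p in Q_adjoin a & q in Q_adjoin a].

Lemma Q_adjoin_spanD {R : realType} (a T x y : R) :
  Q_adjoin_span a T x -> Q_adjoin_span a T y -> Q_adjoin_span a T (x + y).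
Proof.
move=> [p Qp [q Qq <-]] [p' Qp' [q' Qq' <-]].
exists (p + p'); first exact: Q_adjoinD.
by exists (q + q'); [exact: Q_adjoinD|ring].
Qed.

Lemma Q_adjoin_spanZ {R : realType} (a T c x : R) :
  Q_adjoin a c -> Q_adjoin_span a T x -> Q_adjoin_span a T (c * x).
Proof.
move=> Qc [p Qp [q Qq <-]].
exists (c * p); first exact: Q_adjoinM.
by exists (c * q); [exact: Q_adjoinM|ring].
Qed.

Lemma Q_adjoin_span_coef {R : realType} (a T x : R) :
  Q_adjoin a x -> Q_adjoin_span a T x.
Proof. by move=> Qx; exists x => //; exists 0; [exact: Q_adjoin0|ring]. Qed.

(** * The normalized terms of the series *)

(* For [c n = Gamma (n + a + 1) ^+ 2 / Gamma (2 * (n + a) + 1)], this is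
   [c n / (c 0 * (n + a))]. *)
Definition hcb_term {R : realType} (a : R) (n : nat) : R :=
  a^-1 * \prod_(i < n) ((i%:R + a) / (2 * (2 * (i%:R + a) + 1))).

Lemma hcb_termS {R : realType} (a : R) (n : nat) : 0 < a ->
  2 * (2 * (n%:R + a) + 1) * hcb_term a n.+1 = (n%:R + a) * hcb_term a n.
Proof.
move=> a0; rewrite /hcb_term big_ord_recr/=; field.
have : 0 <= n%:R :> R by []; lra.
Qed.

(** With y = n + a, the functional equation, used once in the numerator and twice in the
    denominator, multiplies the left side by (y + 1)^2 / ((2 y + 1) (2 y + 2)); the right side gains
    the same factor (y + 1) / (2 (2 y + 1)). *)
Lemma Gamma_ratio_hcb_term {R : realType} (a : R) (n : nat) : 0 < a ->
  Gamma_fun (n%:R + a + 1) ^+ 2 / Gamma_fun (2 * (n%:R + a) + 1) =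
  Gamma_fun (a + 1) ^+ 2 / Gamma_fun (2 * a + 1) * (hcb_term a n * (n%:R + a)).
Proof.
move=> a0; elim: n => [|n IH].
  by rewrite /hcb_term big_ord0 mulr1 add0r mulVf ?gt_eqF// mulr1.
have n0 : 0 <= n%:R :> R by [].
have -> : n.+1%:R + a + 1 = (n%:R + a + 1) + 1 by rewrite -natr1; ring.
have -> : 2 * (n.+1%:R + a) + 1 = (2 * (n%:R + a) + 1) + 1 + 1.
  by rewrite -natr1; ring.
have GS (y : R) : 0 < y -> Gamma_fun (y + 1) = y * Gamma_fun y by exact: Gamma_funS.
rewrite (GS (n%:R + a + 1)) 1?(GS (2 * (n%:R + a) + 1 + 1))
  ?(GS (2 * (n%:R + a) + 1)); [|lra..].
rewrite exprMn invfM invfM.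
set G := Gamma_fun (n%:R + a + 1) in IH *.
set H := Gamma_fun (2 * (n%:R + a) + 1) in IH *.
transitivity ((n%:R + a + 1) ^+ 2 / (2 * (n%:R + a) + 1) /
    (2 * (n%:R + a) + 1 + 1) * (G ^+ 2 / H)).
  by ring.
rewrite IH; move: (Gamma_fun (a + 1) ^+ 2 / _) => c.
rewrite /hcb_term big_ord_recr/= -natr1.
by field; lra.
Qed.

Lemma hcb_term_ge0 {R : realType} (a : R) (n : nat) : 0 < a -> 0 <= hcb_term a n.
Proof.
move=> a0; rewrite /hcb_term mulr_ge0 ?invr_ge0 ?ltW// prodr_gt0// => i _.
have : 0 <= i%:R :> R by []; move=> i0.
by rewrite divr_gt0//; lra.
Qed.

(** Each factor y / (2 (2 y + 1)) of the product is at most 1/4. *)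
Lemma hcb_term_le {R : realType} (a : R) (n : nat) : 0 < a ->
  hcb_term a n <= a^-1 * 4 ^- n.
Proof.
move=> a0; rewrite /hcb_term ler_pM2l ?invr_gt0//.
elim: n => [|n IH]; first by rewrite big_ord0 expr0 invr1.
have n0 : 0 <= n%:R :> R by [].
rewrite big_ord_recr/= exprSr [leRHS]invfM ler_pM//.
- by apply: prodr_ge0 => i _; rewrite divr_ge0//; have : 0 <= i%:R :> R by []; lra.
- by rewrite divr_ge0//; lra.
- by rewrite ler_pdivrMr; lra.
Qed.

(** * Moments: convergence, recurrence and initial value *)

Definition hcb_moment {R : realType} (a : R) (j : nat) : R :=
  limn (series (fun n : nat => hcb_term a n * (n%:R + a) ^+ j)).

(** The decay 4^-n against the polynomial growth, bounded by C 2^n, leaves a geometric majorant of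
    ratio 1/2. *)
Lemma is_cvg_hcb_moment {R : realType} (a : R) (j : nat) : 0 < a ->
  cvgn (series (fun n : nat => hcb_term a n * (n%:R + a) ^+ j)).
Proof.
move=> a0; have [C C0 HC] := @pow_le_geometric R a 2 j (ltW a0) ltac:(lra).
have na n : 0 <= n%:R + a by rewrite addr_ge0// ltW.
apply: (@series_le_cvg _ _ (geometric (a^-1 * C) (1 / 2))).
- by move=> n; rewrite mulr_ge0 ?hcb_term_ge0 ?exprn_ge0.
- move=> n; apply: geometric_ge0; last by lra.
  by rewrite mulr_ge0 ?invr_ge0 ?(ltW a0).
- move=> n /=.
  apply: (@le_trans _ _ (a^-1 * 4 ^- n * (C * 2 ^+ n))).
    by rewrite ler_pM ?hcb_term_ge0 ?exprn_ge0// hcb_term_le.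
  have -> : (4 : R) = 2 * 2 by ring.
  rewrite exprMn expr_div_n expr1n le_eqVlt; apply/orP; left; apply/eqP; field.
  by rewrite expf_neq0//= ?gt_eqF.
- by apply: is_cvg_geometric_series; rewrite ger0_norm; lra.
Qed.

(** With 2 (2 y + 1) = 4 (y + 1) - 2, summing the functional equation times (y + 1)^j gives 4
    M_(j+1) - 2 M_j without its n = 0 term, which is (4 a - 2) a^j / a; the other side is y (y +
    1)^j t(y), expanded binomially. *)
Lemma hcb_moment_rec {R : realType} (a : R) (j : nat) : 0 < a ->
  4 * hcb_moment a j.+1 - 2 * hcb_moment a j - (4 * a - 2) * a ^+ j / a =
  \sum_(i < j.+1) 'C(j, i)%:R * hcb_moment a i.+1.
Proof.
move=> a0.
pose s i := series (fun n : nat => hcb_term a n * (n%:R + a) ^+ i).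
have sc i : s i n @[n --> \oo] --> hcb_moment a i by exact: is_cvg_hcb_moment.
have scS i : s i n.+1 @[n --> \oo] --> hcb_moment a i.
  by have := sc i; rewrite -cvg_shiftS.
(* The shift y -> y + 1 makes the left partial sums one term longer than the right ones. *)
have E n : 4 * s j.+1 n.+1 - 2 * s j n.+1 - (4 * a - 2) * a ^+ j / a =
    \sum_(i < j.+1) 'C(j, i)%:R * s i.+1 n.
  rewrite /s /series/=; elim: n => [|n IH].
    rewrite !big_nat1 big1 => [|i _]; last by rewrite big_geq ?mulr0.
    rewrite /hcb_term big_ord0 add0r exprS; field; lra.
  rewrite !(big_nat_recr n.+1)//= -[n.+1%:R]natr1.
  under [RHS]eq_bigr do rewrite big_nat_recr//= mulrDr.
  rewrite big_split/= -IH.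
  rewrite (_ : \sum_(i < j.+1) _ = hcb_term a n * (n%:R + a) * (n%:R + 1 + a) ^+ j).
    rewrite [hcb_term a n * _]mulrC -hcb_termS// exprS; ring.
  rewrite (_ : n%:R + 1 + a = 1 + (n%:R + a)); last by ring.
  rewrite exprDn mulr_sumr; apply: eq_bigr => i _.
  by rewrite expr1n mul1r exprS -mulr_natl; ring.
have L : 4 * s j.+1 n.+1 - 2 * s j n.+1 - (4 * a - 2) * a ^+ j / a @[n --> \oo] -->
    4 * hcb_moment a j.+1 - 2 * hcb_moment a j - (4 * a - 2) * a ^+ j / a.
  by apply: cvgB; [apply: cvgB; apply: cvgMr; exact: scS|exact: cvg_cst].
move: L; under eq_fun do rewrite E; move=> L; apply: (cvg_unique _ L) => //.
apply: cvg_big => [|i _]; first exact: add_continuous.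
 apply: cvgMr; exact: sc.
Qed.

Lemma hcb_moment0 {R : realType} (a : R) : 1 / 2 < a ->
  hcb_moment a 0 = 4 `^ a / Num.sqrt 3 *
    incomplete_beta (1 / 4) (a - 1 / 2) (1 / 2) * ((a - 1 / 2) / a).
Proof.
move=> ha; have a0 : 0 < a by lra.
(* Here a > 1/2 enters: all exponents p = n + a - 1/2 of the beta integrals are positive. *)
have a1 n : 0 < n%:R + a - 1 / 2 by have : 0 <= n%:R :> R by []; lra.
have z01 : 0 < (1 / 4 : R) < 1 by apply/andP; split; lra.
have h01 : 0 < (1 / 2 : R) <= 1 by apply/andP; split; lra.
pose I n := incomplete_beta (1 / 4) (n%:R + a - 1 / 2) (1 / 2) : R.
(* [v n - v n.+1] is a constant multiple of [hcb_term a n]. *)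
pose v n := hcb_term a n * 4 ^+ n * ((n%:R + a - 1 / 2) * I n).
(* The factor 4^n in [v] cancels the n-dependence of the boundary term (1/4)^p. *)
have z4 n : 4 ^+ n * (1 / 4 : R) `^ (n%:R + a - 1 / 2) = 2 / 4 `^ a.
  rewrite div1r -powR_inv1// -powRrM.
  rewrite (_ : -1 * (n%:R + a - 1 / 2) = 2^-1 - a - n%:R :> R); last by field.
  have n4 : (4 : R) != 0 by [].
  rewrite !powRB ?n4 ?implybT// powR_mulrn// powR12_sqrt//.
  have -> : Num.sqrt 4 = 2 :> R.
    by rewrite (_ : 4 = 2 ^+ 2) ?sqrtr_sqr ?ger0_norm//; ring.
  by field; rewrite expf_neq0//= gt_eqF// powR_gt0.
have s34 : (1 - 1 / 4 : R) `^ (1 / 2) = Num.sqrt 3 / 2.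
  rewrite (_ : 1 - 1 / 4 = 3 * 2^-1 ^+ 2 :> R); last by field.
  rewrite (_ : 1 / 2 = 2^-1 :> R) ?div1r// powR12_sqrt ?mulr_ge0// sqrtrM//.
  by rewrite sqrtr_sqr ger0_norm.
have s3 : 0 < Num.sqrt (3 : R) by rewrite sqrtr_gt0.
have p4 : 0 < (4 : R) `^ a by rewrite powR_gt0.
(* The boundary term of the beta recurrence gives the right side; the rest, (n + a) I(n + 1), turns
   into [v n.+1] by [hcb_termS]. *)
have vB n : v n - v n.+1 = Num.sqrt 3 / 4 `^ a * hcb_term a n.
  rewrite /v {1}/I incomplete_beta_rec//.
  rewrite (_ : n%:R + a - 1 / 2 + 1 / 2 = n%:R + a); last by ring.
  rewrite (_ : n%:R + a - 1 / 2 + 1 = n.+1%:R + a - 1 / 2); last first.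
    by rewrite -natr1; ring.
  rewrite -/(I n.+1) s34.
  have -> : hcb_term a n * 4 ^+ n *
      ((1 / 4) `^ (n%:R + a - 1 / 2) * (Num.sqrt 3 / 2) + (n%:R + a) * I n.+1) =
      hcb_term a n * (4 ^+ n * (1 / 4) `^ (n%:R + a - 1 / 2)) * (Num.sqrt 3 / 2) +
      (n%:R + a) * hcb_term a n * 4 ^+ n * I n.+1 by ring.
  rewrite z4 -hcb_termS// exprS -natr1; field.
  by rewrite gt_eqF.
have hE : (fun n : nat => hcb_term a n * (n%:R + a) ^+ 0) = hcb_term a.
  by apply/funext => n; rewrite expr0 mulr1.
have hs : cvgn (series (hcb_term a)) by rewrite -hE; exact: is_cvg_hcb_moment.
(* The beta bound gives p I(p) <= const (1/4)^p, hence [v n] <= K [hcb_term a n], which tends to 0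
   as the term of a convergent series. *)
have v0 : v n @[n --> \oo] --> 0.
  pose K := (1 - 1 / 4 : R) `^ (1 / 2 - 1) * (2 / 4 `^ a).
  apply: (@squeeze_cvgr _ _ _ _ (fun=> 0) (fun n => K * hcb_term a n)).
  - near=> n; have /andP[I0 I1] := incomplete_beta_ge0_le
      (1 / 4) (n%:R + a - 1 / 2) (1 / 2) z01 (a1 n) (proj2 (andP h01)).
    apply/andP; split.
      apply: mulr_ge0; first by rewrite mulr_ge0 ?hcb_term_ge0 ?exprn_ge0.
      by rewrite mulr_ge0// ltW.
    rewrite /v /K -(z4 n).
    rewrite ler_pdivlMr// in I1.
    have t4 : 0 <= hcb_term a n * 4 ^+ n.
      by rewrite mulr_ge0 ?hcb_term_ge0 ?exprn_ge0.
    have := ler_wpM2l t4 I1; congr (_ <= _); rewrite /I; ring.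
  - exact: cvg_cst.
  - rewrite -[X in _ --> X](mulr0 K); apply: cvgMr.
    exact: cvg_series_cvg_0.
have vs n : series (hcb_term a) n = 4 `^ a / Num.sqrt 3 * (v 0%N - v n).
  rewrite /series/=; elim: n => [|n IH]; first by rewrite big_geq// subrr mulr0.
  rewrite big_nat_recr//= IH.
  rewrite (_ : v 0%N - v n.+1 = v 0%N - v n + (v n - v n.+1)); last by ring.
  rewrite vB; field.
  by rewrite !gt_eqF.
rewrite /hcb_moment hE; apply/cvg_lim => //.
rewrite (funext vs : series _ = _).
have -> : 4 `^ a / Num.sqrt 3 * incomplete_beta (1 / 4) (a - 1 / 2) (1 / 2) *
    ((a - 1 / 2) / a) =
    4 `^ a / Num.sqrt 3 * (v 0%N - 0).
  by rewrite subr0 /v /I /hcb_term big_ord0 expr0 add0r; ring.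
by apply: cvgMr; apply: cvgB => //; exact: cvg_cst.
Unshelve. all: by end_near. Qed.

(** * Membership of the moments in the span, and the zeta values *)

Lemma hcb_moment_span {R : realType} (k : nat) (a : R) : 1 / 2 < a ->
  Q_adjoin_span a (4 `^ a / Num.sqrt 3 *
    incomplete_beta (1 / 4) (a - 1 / 2) (1 / 2)) (hcb_moment a k).
Proof.
move=> ha; have a0 : 0 < a by lra.
set T := _ * _.
have Qa := Q_adjoin_gen a; have Qn := @Q_adjoin_nat R a.
elim/ltn_ind: k => -[_|j IH].
  exists 0; first exact: Q_adjoin0.
  exists ((a - 1 / 2) / a); last by rewrite add0r hcb_moment0.
  apply: Q_adjoin_div => //; apply: Q_adjoinB => //.
  by apply: Q_adjoin_div; [exact: Q_adjoin1|exact: (Qn 2%N)].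
(* The summand i = j of the recurrence is M_(j+1) itself; moving it across leaves 3 M_(j+1) and only
   moments of index at most j. *)
have -> : hcb_moment a j.+1 = 1 / 3 * (2 * hcb_moment a j +
    ((4 * a - 2) * a ^+ j / a + \sum_(i < j) 'C(j, i)%:R * hcb_moment a i.+1)).
  have := @hcb_moment_rec R a j a0; rewrite big_ord_recr/= binn mul1r; lra.
apply: Q_adjoin_spanZ; first by
  apply: Q_adjoin_div; [exact: Q_adjoin1|exact: (Qn 3%N)].
apply: Q_adjoin_spanD.
  by apply: Q_adjoin_spanZ; [exact: (Qn 2%N)|exact: IH].
apply: Q_adjoin_spanD.
  apply: Q_adjoin_span_coef; apply: Q_adjoin_div => //; apply: Q_adjoinM.
    by apply: Q_adjoinB; [apply: Q_adjoinM => //; exact: (Qn 4%N)|exact: (Qn 2%N)].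
  exact: Q_adjoinX.
apply: (big_ind (Q_adjoin_span a T)).
- by apply: Q_adjoin_span_coef; exact: Q_adjoin0.
- by move=> x y; exact: Q_adjoin_spanD.
- by move=> i _; apply: Q_adjoin_spanZ => //; apply: IH; rewrite ltnS.
Qed.

(** The reciprocal binomial is c(y) = c(a) t(y) y, and its factor y raises y^(k - 1) to y^k. *)
Lemma zetaHCB_moment {R : realType} (k : nat) (a : R) : 0 < a ->
  zetaHCB (1 - k%:R) a =
  Gamma_fun (a + 1) ^+ 2 / Gamma_fun (2 * a + 1) * hcb_moment a k.
Proof.
move=> a0; set c := _ / _.
rewrite /zetaHCB /hcb_moment (_ : (fun n : nat => 1 / _) =
    c *: (fun n : nat => hcb_term a n * (n%:R + a) ^+ k)).
  by rewrite lim_seriesZ//; exact: is_cvg_hcb_moment.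
apply/funext => n; rewrite fctE /GRing.scale/=.
have x0 : 0 < n%:R + a by rewrite ltr_wpDl.
rewrite powRB ?powRr1 ?powR_mulrn ?(ltW x0)//; last by rewrite (gt_eqF x0) implybT.
rewrite /rbinom (_ : 2 * (n%:R + a) - (n%:R + a) = n%:R + a); last by ring.
rewrite div1r [LHS]invfM (invf_div (Gamma_fun _)) (invf_div (n%:R + a)) -expr2.
rewrite Gamma_ratio_hcb_term// -/c.
field; lra.
Qed.

Theorem theorem3p7 (R : realType) (k : nat) (a : R) (ha : 1 / 2 < a) :
  [set Gamma_fun (a + 1) ^+ 2 / Gamma_fun (2 * a + 1) *
       (p + 4 `^ a / Num.sqrt 3 * incomplete_beta (1 / 4) (a - 1 / 2) (1 / 2) * q)
    | p in Q_adjoin a & q in Q_adjoin a] (zetaHCB (1 - k%:R) a).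
Proof.
have [p Qp [q Qq pq]] := hcb_moment_span k a ha.
exists p => //; exists q => //.
by rewrite pq zetaHCB_moment//; lra.
Qed.
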